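(* Let $X$ be a real Banach space, $k\in\mathbb{Z}^+$ and $r>1$. Then the following statements are equivalent. (1) $X$ is $k$-WMLUR. (2) $B_X$ is $k$-$w$SCh on $X$. (3) $B_X$ is $k$-$w$SCh on $rS_X$.
   Context: $B_X$ and $S_X$ are the closed unit ball and unit sphere of $X$; $X^*$ is the dual of $X$. For $x_1,\dots,x_{k+1}\in X$ and $f_1,\dots,f_k\in X^*$, $D_k[(x_i)_{i=1}^{k+1};(f_j)_{j=1}^{k}]$ denotes the determinant of the $(k+1)\times(k+1)$ matrix whose first row consists of ones and whose $(j+1,i)$ entry is $f_j(x_i)$. $X$ is $k$-weakly midpoint locally uniformly rotund ($k$-WMLUR) if for any $x\in S_X$ and any sequences $(x_n^{(1)}),\dots,(x_n^{(k+1)})$ in $S_X$ with $\|(k+1)x-\sum_{i=1}^{k+1}x_n^{(i)}\|\to0$, it follows that $D_k[(x_n^{(i)})_{i=1}^{k+1};(f_j)_{j=1}^{k}]\to0$ for all $f_1,\dots,f_k\in S_{X^*}$. For a non-empty $A\subseteq X$, $x\in X$, $\delta>0$: $d(x,A)=\inf\{\|x-y\|:y\in A\}$ and $P_A(x,\delta)=\{y\in A:\|x-y\|\le d(x,A)+\delta\}$. $A$ is proximinal at $x$ if there is $y\in A$ with $\|x-y\|=d(x,A)$. $A$ is $k$-weakly strongly Chebyshev ($k$-$w$SCh) at $x$ if $A$ is proximinal at $x$ and for every $\epsilon>0$ and $f_1,\dots,f_k\in S_{X^*}$ there exists $\delta>0$ such that $|D_k[(x_i)_{i=1}^{k+1};(f_j)_{j=1}^{k}]|\le\epsilon$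 whenever $x_1,\dots,x_{k+1}\in P_A(x,\delta)$. $A$ is $k$-$w$SCh on $B\subseteq X$ if it is $k$-$w$SCh at every $x\in B$. *)

(* Defs.v *)
From HB Require Import structures.
From mathcomp Require Import all_boot all_order all_algebra.
From mathcomp Require Import all_classical all_reals all_analysis.

Set Implicit Arguments.
Unset Strict Implicit.
Unset Printing Implicit Defensive.

Import Order.TTheory GRing.Theory Num.Theory.
Import numFieldNormedType.Exports.

Local Open Scope classical_set_scope.
Local Open Scope ring_scope.

Definition unit_ball (R : realType) (X : normedModType R) : set X :=
  [set x | `|x| <= 1].

Definition unit_sphere (R : realType) (X : normedModType R) : set X :=
  [set x | `|x| = 1].

Arguments unit_ball {R} X.
Arguments unit_sphere {R} X.

Definition dual_norm (R : realType) (X : normedModType R)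
    (f : {linear X -> R^o}) : R :=
  sup [set `|f x : R| | x in unit_ball X].

(* Continuity has to be required separately: [sup] is a total function, so
   [dual_norm f] is a junk value when [f] is unbounded. *)
Definition dual_unit_sphere (R : realType) (X : normedModType R) :
    set {linear X -> R^o} :=
  [set f : {linear X -> R^o} | continuous f /\ dual_norm f = 1].

Arguments dual_unit_sphere {R} X.

Definition Ddet (R : realType) (X : normedModType R) (k : nat)
    (x : 'I_k.+1 -> X) (f : 'I_k -> {linear X -> R^o}) : R :=
  \det (col_mx (const_mx 1 : 'rV[R]_k.+1)
               (\matrix_(j < k, i < k.+1) (f j (x i) : R)) : 'M[R]_k.+1).

Definition kWMLUR (R : realType) (X : normedModType R) (k : nat) : Prop :=
  forall (x : X) (u : 'I_k.+1 -> nat -> X),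
    unit_sphere X x ->
    (forall i n, unit_sphere X (u i n)) ->
    (fun n => `|k.+1%:R *: x - \sum_(i < k.+1) u i n|) @ \oo --> (0 : R) ->
    forall f : 'I_k -> {linear X -> R^o},
      (forall j, dual_unit_sphere X (f j)) ->
      (fun n => Ddet (fun i => u i n) f) @ \oo --> (0 : R).

Arguments kWMLUR {R} X k.

(* Meaningful for nonempty [A] only ([inf set0] is a junk value). *)
Definition set_dist (R : realType) (X : normedModType R) (x : X) (A : set X) :
    R :=
  inf [set `|x - y| | y in A].

Definition near_proj (R : realType) (X : normedModType R) (A : set X) (x : X)
    (delta : R) : set X :=
  [set y | A y /\ `|x - y| <= set_dist x A + delta].

Definition proximinal_at (R : realType) (X : normedModType R) (A : set X)
    (x : X) : Prop :=
  exists2 y, A y & `|x - y| = set_dist x A.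

Definition kwSCh_at (R : realType) (X : normedModType R) (k : nat) (A : set X)
    (x : X) : Prop :=
  proximinal_at A x /\
  forall (eps : R) (f : 'I_k -> {linear X -> R^o}),
    0 < eps -> (forall j, dual_unit_sphere X (f j)) ->
    exists2 delta : R, 0 < delta &
      forall y : 'I_k.+1 -> X,
        (forall i, near_proj A x delta (y i)) -> `|Ddet y f| <= eps.

Definition kwSCh_on (R : realType) (X : normedModType R) (k : nat)
    (A B : set X) : Prop :=
  forall x, B x -> kwSCh_at k A x.

(* Main.v *)
(** [D_k] is translation invariant and homogeneous of degree [k], so a determinant
   can be tested on any affine contraction of the points.
   Let [|x| = s > 1] and [x' = x / s].  If [y] is a nearly nearest point to [x] in
   the ball, then both [x' + (y - x') / s] and [x' - (y - x') / s] nearly lie in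
   the ball.  Hence, for nearly nearest points [y_i] with mean [m], so do the points
   [u_i = x' + (y_i - m) / (2 s)], being averages of such points.  As their mean is
   [x'], their norms are near 1, and rotundity at [x'] applies once they are
   normalized.
   Conversely, if [u_i] are unit vectors with mean near the unit vector [x], then
   for small [c] the points [x + c (u_i - x)] of the ball are nearly nearest to
   [r x], because [u_i] is nearly [(k + 1) x] minus the sum of the other [u_j]. *)
Require Import Defs.
From HB Require Import structures.
From mathcomp Require Import all_boot all_order all_algebra.
From mathcomp Require Import all_classical all_reals all_analysis.
From mathcomp Require Import perm ring lra.
Import Order.TTheory GRing.Theory Num.Theory.
Import numFieldNormedType.Exports.
Local Open Scope classical_set_scope.
Local Open Scope ring_scope.

(** * Determinants [Ddet]: affine behaviour and Lipschitz bound *)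

Lemma dual_unit_sphere_le {R : realType} {X : normedModType R}
    (f : {linear X -> R^o}) (x : X) :
  dual_unit_sphere X f -> `|f x : R| <= `|x|.
Proof.
case=> _ f1.
(* [sup] defaults to 0 on a set without supremum, so the value 1 forces boundedness. *)
have hs : has_sup [set `|f x : R| | x in unit_ball X].
  by apply: contrapT => /sup_out; rewrite -/(dual_norm f) f1; apply/eqP/oner_neq0.
have [->|x0] := eqVneq x 0; first by rewrite linear0 !normr0.
have nx : 0 < `|x| by rewrite normr_gt0.
have : `|f (`|x|^-1 *: x) : R| <= 1.
  rewrite -f1; apply: ub_le_sup; first exact: hs.2.
  exists (`|x|^-1 *: x) => //.
  by rewrite /unit_ball /= normrZ normfV normr_id mulVf // gt_eqF.
by rewrite linearZ /= normrM normfV normr_id mulrC ler_pdivrMr // mul1r.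
Qed.

(** The row of ones turns translation into a row operation: the map acts as left multiplication by a
    block lower triangular matrix with diagonal blocks 1 and [c%:M]. *)
Lemma Ddet_affine {R : realType} {X : normedModType R} {k : nat} (c : R) (z : X)
    (y : 'I_k.+1 -> X) (f : 'I_k -> {linear X -> R^o}) :
  Ddet (fun i => c *: y i + z) f = c ^+ k * Ddet y f.
Proof.
rewrite /Ddet.
set M := col_mx _ (\matrix_(j, i) (f j (y i) : R)).
pose w : 'cV[R]_k := \col_j (f j z : R).
rewrite (_ : col_mx _ _ = block_mx (1%:M : 'M[R]_1) 0 w (c%:M : 'M[R]_k) *m M).
  transitivity
    (\det (block_mx (1%:M : 'M[R]_1) 0 w (c%:M : 'M[R]_k)) * (\det M)).
    exact: det_mulmx.
  by rewrite det_lblock det1 mul1r det_scalar.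
rewrite mul_block_col mul1mx mul0mx addr0 mul_scalar_mx; congr col_mx.
apply/matrixP => j i; rewrite !mxE big_ord1 !mxE mulr1 addrC.
by rewrite linearD linearZ.
Qed.

Lemma Ddet_const {R : realType} {X : normedModType R} {k : nat} (z : X)
    (f : 'I_k -> {linear X -> R^o}) :
  (0 < k)%N -> Ddet (fun=> z) f = 0.
Proof.
move=> k0; have := Ddet_affine 0 z (fun=> 0) f.
rewrite expr0n eqn0Ngt k0 mul0r => <-; congr (Ddet _ f).
by apply/funext => i; rewrite scale0r add0r.
Qed.

(** Factors are exchanged one at a time; [1 <= K] lets each error term be padded to the full power
    of [K]. *)
Lemma prod_lipschitz {R : realType} (I : Type) (s : seq I) (a b : I -> R)
    (K e : R) :
  1 <= K -> 0 <= e ->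
  (forall i, `|a i| <= K) -> (forall i, `|b i| <= K) ->
  (forall i, `|a i - b i| <= e) ->
  `|\prod_(i <- s) a i - \prod_(i <- s) b i| <= (size s)%:R * K ^+ size s * e.
Proof.
move=> K1 e0 aK bK ab; have K0 : 0 <= K by apply: le_trans K1.
have prodK t : `|\prod_(i <- t) b i| <= K ^+ size t.
  elim: t => [|i t IH]; first by rewrite big_nil normr1.
  by rewrite big_cons normrM /= exprS ler_pM.
elim: s => [|i s IH]; first by rewrite !big_nil subrr normr0 !mul0r.
rewrite !big_cons /=.
set p := \prod_(_ <- _) _ in IH *; set q := \prod_(_ <- _) _ in IH *.
have -> : a i * p - b i * q = a i * (p - q) + (a i - b i) * q by ring.
apply: le_trans (ler_normD _ _) _; rewrite !normrM.
have h1 : `|a i| * `|p - q| <= K * ((size s)%:R * K ^+ size s * e).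
  exact: ler_pM.
have h2 : `|a i - b i| * `|q| <= e * K ^+ size s by exact: ler_pM (prodK s).
have h3 : e * K ^+ size s <= K * (e * K ^+ size s).
  by rewrite ler_peMl // mulr_ge0 // exprn_ge0.
rewrite -(natr1 (size s)) exprS.
apply: le_trans (lerD h1 (le_trans h2 h3)) _.
by rewrite le_eqVlt; apply/orP; left; apply/eqP; ring.
Qed.

(** In the Leibniz expansion each of the [k.+1]! terms is a product of [k.+1] entries bounded by
    [K], the ones because [1 <= K], the others because the functionals have norm 1. *)
Lemma Ddet_lipschitz {R : realType} {X : normedModType R} {k : nat}
    (f : 'I_k -> {linear X -> R^o}) (K e : R) (u v : 'I_k.+1 -> X) :
  (forall j, dual_unit_sphere X (f j)) ->
  1 <= K -> 0 <= e ->
  (forall i, `|u i| <= K) -> (forall i, `|v i| <= K) ->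
  (forall i, `|u i - v i| <= e) ->
  `|Ddet u f - Ddet v f| <= (k.+1`!)%:R * (k.+1%:R * K ^+ k.+1 * e).
Proof.
move=> hf K1 e0 uK vK uv; rewrite /Ddet.
set U := col_mx _ _; set V := col_mx _ _; rewrite /determinant -sumrB.
apply: le_trans (ler_norm_sum _ _ _) _.
pose B := k.+1%:R * K ^+ k.+1 * e.
suff H (s : 'S_k.+1) :
    `|(-1) ^+ s * \prod_i U i (s i) - (-1) ^+ s * \prod_i V i (s i)| <= B.
  apply: le_trans (ler_sum _ (fun s _ => H s)) _.
  by rewrite sumr_const card_Sn mulr_natl.
rewrite -mulrBr normrM normrX normrN1 expr1n mul1r /B.
have -> : k.+1%:R * K ^+ k.+1 * e =
    (size (index_enum 'I_k.+1))%:R * K ^+ size (index_enum 'I_k.+1) * e.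
  by rewrite -sum1_size sum1_card card_ord.
apply: prod_lipschitz => // i; rewrite /U /V !mxE; case: fintype.split => j; rewrite !mxE.
- by rewrite normr1.
- exact: le_trans (dual_unit_sphere_le _ _ (hf j)) (uK _).
- by rewrite normr1.
- exact: le_trans (dual_unit_sphere_le _ _ (hf j)) (vK _).
- by rewrite subrr normr0.
- rewrite -linearB; exact: le_trans (dual_unit_sphere_le _ _ (hf j)) (uv _).
Qed.

(** * Distance to the unit ball and radial projection *)

Lemma set_dist_attained {R : realType} {X : normedModType R} {A : set X}
    {x y : X} :
  A y -> (forall z, A z -> `|x - y| <= `|x - z|) -> set_dist x A = `|x - y|.
Proof.
move=> Ay ymin; apply/eqP; rewrite eq_le; apply/andP; split.
  apply: ge_inf; last by exists y.
  by exists 0 => _ [z _ <-].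
apply: lb_le_inf; first by exists `|x - y|, y.
by move=> _ [z Az <-]; exact: ymin.
Qed.

Lemma sub_normalize {R : realType} {X : normedModType R} {x : X} :
  x != 0 -> `|x - `|x|^-1 *: x| = `| `|x| - 1 |.
Proof.
move=> x0; rewrite -{1}[x]scale1r -scalerBl normrZ.
rewrite -{2}[`|x|]normr_id -normrM mulrBl mul1r mulVf //.
by rewrite normr_eq0.
Qed.

Lemma norm_normalize {R : realType} {X : normedModType R} {x : X} :
  x != 0 -> `| `|x|^-1 *: x | = 1.
Proof. by move=> x0; rewrite normrZ normfV normr_id mulVf // normr_eq0. Qed.

Lemma unit_ball_nearest {R : realType} {X : normedModType R} {x : X} :
  1 <= `|x| ->
  unit_ball X (`|x|^-1 *: x) /\
  `|x - `|x|^-1 *: x| = set_dist x (unit_ball X).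
Proof.
move=> x1; have x0 : x != 0 by rewrite -normr_gt0; apply: lt_le_trans x1.
have bx : unit_ball X (`|x|^-1 *: x) by rewrite /unit_ball /= norm_normalize.
split=> //; rewrite (set_dist_attained bx) // => z zB.
rewrite sub_normalize // ger0_norm ?subr_ge0 //.
by have := lerB_dist x z; have : `|z| <= 1 := zB; lra.
Qed.

Lemma set_dist_unit_ball {R : realType} {X : normedModType R} {x : X} :
  1 <= `|x| -> set_dist x (unit_ball X) = `|x| - 1.
Proof.
move=> x1; have [_ <-] := unit_ball_nearest x1.
by rewrite sub_normalize ?ger0_norm ?subr_ge0 // -normr_gt0 (lt_le_trans _ x1).
Qed.

Lemma set_dist_mem {R : realType} {X : normedModType R} {A : set X} {x : X} :
  A x -> set_dist x A = 0.
Proof. by move=> Ax; rewrite (set_dist_attained Ax) subrr normr0. Qed.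

(** * Rotundity in epsilon-delta form *)

Lemma kWMLUR_uniformP {R : realType} {X : normedModType R} {k : nat} :
  kWMLUR X k <->
  forall (x : X) (f : 'I_k -> {linear X -> R^o}) (eps : R),
    unit_sphere X x -> (forall j, dual_unit_sphere X (f j)) -> 0 < eps ->
    exists2 delta : R, 0 < delta &
      forall u : 'I_k.+1 -> X, (forall i, unit_sphere X (u i)) ->
        `|k.+1%:R *: x - \sum_(i < k.+1) u i| <= delta -> `|Ddet u f| <= eps.
Proof.
split=> [H x f eps x1 hf e0|H x u x1 u1 ucv f hf].
  apply: contrapT => /forall2NP nd.
  (* Failure at every [delta = 1/(n+1)] yields sequences that contradict rotundity. *)
  have /choice[u hu] (n : nat) : exists u : 'I_k.+1 -> X,
      [/\ (forall i, unit_sphere X (u i)),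
        `|k.+1%:R *: x - \sum_(i < k.+1) u i| <= n.+1%:R^-1
        & eps < `|Ddet u f|].
    have [|] := nd n.+1%:R^-1; first by rewrite invr_gt0 ltr0n.
    move=> /existsNP[u /not_implyP[u1 /not_implyP[us uD]]]; exists u; split=> //.
    by rewrite ltNge; apply/negP.
  have cv : (fun n => `|k.+1%:R *: x - \sum_(i < k.+1) u n i|) @ \oo --> (0 : R).
    apply: (@squeeze_cvgr _ _ _ _ (fun=> 0) (@harmonic R)).
    - by near=> n; have [_ h _] := hu n; rewrite normr_ge0 h.
    - exact: cvg_cst.
    - exact: cvg_harmonic.
  have := H x (fun i n => u n i) x1 (fun i n => let: And3 h _ _ := hu n in h i)
    cv f hf.
  move=> /cvgr0Pnorm_le /(_ _ e0)[N _ /(_ N (leqnn N))] /=.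
  by have [_ _ h] := hu N; rewrite leNgt h.
apply/cvgr0Pnorm_le => eps e0.
have [d d0 hd] := H x f eps x1 hf e0.
move/cvgr0Pnorm_le : ucv => /(_ _ d0); apply: filterS => n.
by rewrite normr_id => h; apply: hd.
Unshelve. all: by end_near.
Qed.

(** The sum has norm [k.+1], and the other [k] points contribute at most [k * (1 + d)] to it. *)
Lemma norm_ge_from_sum {R : realType} {X : normedModType R} {k : nat} (x : X)
    (u : 'I_k.+1 -> X) (d : R) (i : 'I_k.+1) :
  `|x| = 1 -> \sum_(j < k.+1) u j = k.+1%:R *: x ->
  (forall j, `|u j| <= 1 + d) -> 1 - k%:R * d <= `|u i|.
Proof.
move=> x1 us ud.
have h : `|k.+1%:R *: x| <= `|u i| + k%:R * (1 + d).
  rewrite -us (bigD1 i) //=; apply: le_trans (ler_normD _ _) _; rewrite lerD2l.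
  apply: le_trans (ler_norm_sum _ _ _) _.
  apply: le_trans (ler_sum _ (fun j _ => ud j)) _.
  by rewrite sumr_const cardC1 card_ord mulr_natl.
by move: h; rewrite normrZ x1 mulr1 normr_nat -natr1; lra.
Qed.

(** * From rotundity to the strong Chebyshev property *)

(** Here the distance is 0, so near-projections cluster at [x] and the determinant is close to that
    of a constant family, which vanishes. *)
Lemma kwSCh_at_mem {R : realType} {X : normedModType R} {k : nat}
    (A : set X) (x : X) :
  (0 < k)%N -> A x -> kwSCh_at k A x.
Proof.
move=> k0 Ax; split; first by exists x => //; rewrite subrr normr0 set_dist_mem.
move=> eps f e0 hf.
pose C : R := (k.+1`!)%:R * (k.+1%:R * (`|x| + 1) ^+ k.+1).
have C0 : 0 < C.
  by rewrite !mulr_gt0 ?ltr0n ?fact_gt0 // exprn_gt0 // ltr_wpDl.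
(* The cap 1 keeps the points in the ball of radius [|x| + 1], where [C] is a Lipschitz constant. *)
exists (Num.min 1 (eps / C)); first by rewrite lt_min ltr01 divr_gt0.
move=> y hy; rewrite -[Ddet y f]subr0 -(Ddet_const x f k0).
have yd i : `|y i - x| <= Num.min 1 (eps / C).
  by have [_] := hy i; rewrite set_dist_mem // add0r distrC.
apply: le_trans (Ddet_lipschitz f (`|x| + 1) (eps / C) _ _ hf _ _ _ _ _) _.
- by rewrite lerDr.
- by rewrite divr_ge0 // ltW.
- move=> i; rewrite -[y i](subrK x) addrC; apply: le_trans (ler_normD _ _) _.
  by rewrite lerD2l; apply: le_trans (yd i) _; rewrite ge_min lexx.
- by move=> i; rewrite lerDl.
- by move=> i; apply: le_trans (yd i) _; rewrite ge_min lexx orbT.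
- by rewrite mulrA -/C mulrC divfK // gt_eqF.
Qed.

Lemma kWMLUR_kwSCh {R : realType} {X : normedModType R} {k : nat} :
  (0 < k)%N -> kWMLUR X k -> kwSCh_on k (unit_ball X) [set: X].
Proof.
move=> k0 /kWMLUR_uniformP H x _.
have [xB|/negP] := boolP (`|x| <= 1); first exact: kwSCh_at_mem.
move/negP; rewrite -ltNge => x1.
split; first by exists (`|x|^-1 *: x); have [] := unit_ball_nearest (ltW x1).
move=> eps f e0 hf.
have x0 : x != 0 by rewrite -normr_gt0; apply: lt_trans x1.
set s := `|x| in x1; pose x' : X := s^-1 *: x.
have x'E : x' = s^-1 *: x by [].
have s0 : 0 < s by apply: lt_trans x1.
have x'1 : `|x'| = 1 by exact: norm_normalize.
clearbody x'.
pose c : R := (2 * s)^-1.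
have c0 : 0 < c by rewrite invr_gt0 mulr_gt0.
have ck0 : 0 < c ^+ k by rewrite exprn_gt0.
(* Half of the scaled tolerance: rotundity and normalization each cost one [eta]. *)
pose eta : R := c ^+ k * eps / 2.
have eta0 : 0 < eta by rewrite !mulr_gt0 // invr_gt0.
have [d d0 hd] := H x' f eta x'1 hf eta0.
pose C : R := (k.+1`!)%:R * (k.+1%:R * 2 ^+ k.+1).
have C0 : 0 < C by rewrite !mulr_gt0 ?ltr0n ?fact_gt0 // exprn_gt0.
(* [e] bounds the distance between the points [u i] and their normalizations *)
pose e : R := Num.min (2^-1) (Num.min (d / k.+1%:R) (eta / C)).
have e0' : 0 < e.
  by rewrite !lt_min invr_gt0 (divr_gt0 d0) ?ltr0n //= divr_gt0.
(* The first bound keeps the [u i] away from 0, the second makes their normalizations admissible for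
   [d], the third makes the Lipschitz error at most [eta]. *)
have e1 : e <= 2^-1 by rewrite ge_min lexx.
have e2 : e <= d / k.+1%:R by rewrite !ge_min lexx orbT.
have e3 : e <= eta / C by rewrite !ge_min lexx !orbT.
(* With this choice the lower bound [1 - k * dl] on the norms is at least [1 - e]. *)
pose dl : R := e / k.+1%:R.
have dl0 : 0 < dl by rewrite divr_gt0 ?ltr0n.
have dlk : k.+1%:R * dl = e by rewrite mulrC divfK // pnatr_eq0.
have kdl : k%:R * dl = e - dl by rewrite -dlk -natr1; ring.
have kdl0 : 0 <= k%:R * dl by rewrite mulr_ge0 // ltW.
exists dl => // y hy.
have y1 i : `|y i| <= 1 by have [] := hy i.
have yd i : `|x - y i| <= s - 1 + dl.
  by have [_] := hy i; rewrite set_dist_unit_ball // ltW.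
pose ybar := k.+1%:R^-1 *: \sum_(j < k.+1) y j.
have yb : k.+1%:R *: ybar = \sum_(j < k.+1) y j.
  by rewrite scalerA mulfV ?scale1r // pnatr_eq0.
clearbody ybar.
pose u i := c *: y i + (x' - c *: ybar).
have uD : Ddet u f = c ^+ k * Ddet y f by exact: Ddet_affine.
have kn0 : k.+1%:R != 0 :> R by rewrite pnatr_eq0.
have us : \sum_(j < k.+1) u j = k.+1%:R *: x'.
  rewrite big_split /= -scaler_sumr sumr_const card_ord -scaler_nat scalerBr.
  by rewrite -yb !scalerA [c * _]mulrC addrC subrK.
have ule i : `|u i| <= 1 + dl.
  pose p := x' + s^-1 *: (y i - x').
  pose q j := x' - s^-1 *: (y j - x').
  have pn : `|p| <= 1.
    have -> : p = (1 - s^-1) *: x' + s^-1 *: y i.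
      by rewrite /p scalerBr scalerBl scale1r addrA addrAC.
    have si1 : s^-1 <= 1 by rewrite invf_le1 // ltW.
    apply: le_trans (ler_normD _ _) _; rewrite !normrZ x'1 mulr1.
    rewrite ger0_norm ?subr_ge0 // normfV (gtr0_norm s0).
    have : s^-1 * `|y i| <= s^-1 by rewrite ler_piMr // invr_ge0 ltW.
    lra.
  have qn j : `|q j| <= 1 + dl.
    (* As [x' = x / s], the norm is at most [(s - 1 + dl) / s + 1 / s = 1 + dl / s]. *)
    have -> : q j = s^-1 *: (x - y j) + s^-1 *: x'.
      rewrite /q [in RHS]scalerBr -x'E scalerBr opprB addrA.
      by rewrite addrAC.
    apply: le_trans (ler_normD _ _) _; rewrite !normrZ x'1 mulr1.
    rewrite normfV (gtr0_norm s0) -{2}[s^-1]mulr1 -mulrDr mulrC.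
    rewrite ler_pdivrMr //.
    have : dl <= dl * s by rewrite ler_peMr // ltW.
    by have := yd j; lra.
  (* [u i] is the midpoint of [p] and the mean of the [q j]: the two [x'] terms average to [x'], and
     the difference [y i - ybar] remains. *)
  have -> : u i = 2^-1 *: (p + k.+1%:R^-1 *: \sum_(j < k.+1) q j).
    have -> : k.+1%:R^-1 *: \sum_(j < k.+1) q j = x' - s^-1 *: (ybar - x').
      rewrite sumrB -scaler_sumr sumrB sumr_const card_ord.
      rewrite -[x' *+ _]scaler_nat -yb -scalerBr.
      have -> : s^-1 *: (k.+1%:R *: (ybar - x')) =
          k.+1%:R *: (s^-1 *: (ybar - x')) by rewrite !scalerA mulrC.
      by rewrite -scalerBr scalerA mulVf // scale1r.
    rewrite /p addrACA -scalerBr opprB addrA subrK -mulr2n -[x' *+ _]scaler_nat.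
    rewrite scalerDr !scalerA mulVf ?pnatr_eq0 // scale1r -invfM -/c.
    by rewrite scalerBr /u addrCA.
  rewrite normrZ normfV ger0_norm // mulrC ler_pdivrMr //.
  apply: le_trans (ler_normD _ _) _.
  have : `|k.+1%:R^-1 *: \sum_(j < k.+1) q j| <= 1 + dl.
    rewrite normrZ normfV normr_nat mulrC ler_pdivrMr ?ltr0n //.
    apply: le_trans (ler_norm_sum _ _ _) _.
    apply: le_trans (ler_sum _ (fun j _ => qn j)) _.
    by rewrite sumr_const card_ord mulr_natr.
  by move: pn; lra.
have uge i : 1 - e <= `|u i|.
  by have := norm_ge_from_sum x' u dl i x'1 us ule; rewrite kdl; lra.
have u0 i : u i != 0 by rewrite -normr_gt0; have := uge i; lra.
pose v i := `|u i|^-1 *: u i.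
have v1 i : unit_sphere X (v i) by exact: norm_normalize.
have uv i : `|u i - v i| <= e.
  rewrite sub_normalize // ler_norml.
  by have := uge i; have := ule i; move: kdl0; rewrite kdl; lra.
have vD : `|Ddet v f| <= eta.
  (* Since the [u i] have mean exactly [x'], the defect of the [v i] is the sum of the [k.+1] errors
     [u i - v i]. *)
  apply: hd => //; rewrite -us -sumrB.
  apply: le_trans (ler_norm_sum _ _ _) _.
  apply: le_trans (ler_sum _ (fun j _ => uv j)) _.
  by rewrite sumr_const card_ord -mulr_natr -ler_pdivlMr // ltr0n.
have uvD : `|Ddet u f - Ddet v f| <= eta.
  apply: le_trans (Ddet_lipschitz f 2 e u v hf _ _ _ _ uv) _.
  - lra.
  - exact: ltW.
  - by move=> i; have := ule i; move: kdl0; rewrite kdl; lra.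
  - by move=> i; rewrite (v1 i); lra.
  - by rewrite mulrA -/C mulrC -ler_pdivlMr.
have : c ^+ k * `|Ddet y f| <= c ^+ k * eps.
  rewrite -{1}(gtr0_norm ck0) -normrM -uD -[Ddet u f](subrK (Ddet v f)).
  apply: le_trans (ler_normD _ _) _; apply: le_trans (lerD uvD vD) _.
  by rewrite /eta -splitr.
by rewrite ler_pM2l.
Qed.

(** * From the strong Chebyshev property on a sphere back to rotundity *)

Lemma kwSCh_kWMLUR {R : realType} {X : normedModType R} {k : nat} (r : R) :
  (0 < k)%N -> 1 < r ->
  kwSCh_on k (unit_ball X) [set r *: x | x in unit_sphere X] -> kWMLUR X k.
Proof.
move=> k0 r1 H; apply/kWMLUR_uniformP => x f eps x1 hf e0.
have nx : `|x| = 1 by [].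
have r0 : 0 < r by apply: lt_trans r1.
have nrx : `|r *: x| = r by rewrite normrZ nx mulr1 gtr0_norm.
(* The bound 1 makes the [v i] below convex combinations of [u i] and [x]; the other keeps the
   coefficient [r - 1 - c * k] nonnegative. *)
pose c : R := Num.min 1 ((r - 1) / k%:R).
have kR : 0 < k%:R :> R by rewrite ltr0n.
have c0 : 0 < c by rewrite lt_min ltr01 divr_gt0 // subr_gt0.
have c1 : c <= 1 by rewrite ge_min lexx.
have ck : c * k%:R <= r - 1 by rewrite -ler_pdivlMr // ge_min lexx orbT.
have ck0 : 0 < c ^+ k by rewrite exprn_gt0.
have [|_ /(_ (c ^+ k * eps) f)[|//|d d0 hd]] := H (r *: x); first by exists x.
  by rewrite mulr_gt0.
exists d => // u u1 us.
pose v i := c *: u i + (1 - c) *: x.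
suff : `|Ddet v f| <= c ^+ k * eps.
  by rewrite Ddet_affine normrM (gtr0_norm ck0) ler_pM2l.
apply: hd => i; split.
  rewrite /unit_ball /=; apply: le_trans (ler_normD _ _) _.
  rewrite !normrZ nx (u1 i) !mulr1 (gtr0_norm c0) ger0_norm ?subr_ge0 //.
  by lra.
rewrite set_dist_unit_ball nrx ?(ltW r1) //.
(* The three summands have norms at most [r - 1 - c * k], [c * d] and [c * k], so the total is at
   most [r - 1 + d]. *)
have -> : r *: x - v i = (r - 1 - c * k%:R) *: x +
    c *: ((k.+1%:R *: x - \sum_(j < k.+1) u j) + \sum_(j < k.+1 | j != i) u j).
  have -> : k.+1%:R *: x - \sum_(j < k.+1) u j + \sum_(j < k.+1 | j != i) u j =
      k.+1%:R *: x - u i by rewrite (bigD1 i) //= opprD addrA subrK.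
  rewrite scalerBr scalerA addrA -scalerDl.
  rewrite /v opprD addrA addrAC -scalerBl; congr (_ *: _ - _).
  by rewrite -natr1; ring.
apply: le_trans (ler_normD _ _) _; rewrite !normrZ nx mulr1.
rewrite ger0_norm ?subr_ge0 // (gtr0_norm c0).
have sn : `|\sum_(j < k.+1 | j != i) u j| <= k%:R.
  apply: le_trans (ler_norm_sum _ _ _) _.
  rewrite (eq_bigr (fun=> 1)) => [|j _]; last exact: u1.
  by rewrite sumr_const cardC1 card_ord.
have := ler_normD (k.+1%:R *: x - \sum_(j < k.+1) u j) (\sum_(j < k.+1 | j != i) u j).
set N := `|_ + _| => hN.
have : c * N <= c * (d + k%:R) by rewrite ler_pM2l //; lra.
have : c * d <= d by rewrite ler_piMl // ltW.
by lra.
Qed.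

Theorem theorem3p21 (R : realType) (X : completeNormedModType R) (k : nat)
    (r : R) (hk : (0 < k)%N) (hr : 1 < r) :
  (kWMLUR X k <-> kwSCh_on k (unit_ball X) [set: X]) /\
  (kwSCh_on k (unit_ball X) [set: X] <->
   kwSCh_on k (unit_ball X) [set r *: x | x in unit_sphere X]).
Proof.
have all_sphere : kwSCh_on k (unit_ball X) [set: X] ->
    kwSCh_on k (unit_ball X) [set r *: x | x in unit_sphere X].
  by move=> H x _; exact: H.
have sphere_rotund := kwSCh_kWMLUR r hk hr (X := X).
have rotund_all := kWMLUR_kwSCh hk (X := X).
by split; split; auto.
Qed.
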